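(* Let $G$ be a strongly connected row-finite graph with infinitely many vertices and at most countably many exits. Then $G$ contains a bare exit.
   Context: $G$ is a countable directed graph with vertex set $V$ and edge set $E$ (multiple edges and loops allowed); $s(e), r(e)$ denote source and range of $e\in E$. $G$ is row-finite when every vertex emits only finitely many edges, and strongly connected when for all $v,w\in V$ there is a finite directed path from $v$ to $w$. An exit path is a sequence $(v_i)_{i=1}^\infty$ of vertices such that there is an edge from $v_i$ to $v_{i+1}$ for all $i$ and for every finite $M\subseteq V$ one has $v_i\notin M$ for all large $i$. Exit paths $(t_i),(t'_i)$ are tail equivalent when there is $k\in\mathbb Z$ with $t_{i+k}=t'_i$ for all large $i$. An exit is a tail equivalence class of exit paths. An exit path $(v_i)_{i=1}^\infty$ is bare when $\#\,s(r^{-1}(v_{i+1}))=1$ for all $i\ge 1$ (i.e. all edges ending at $v_{i+1}$ start at $v_i$). An exit is bare when one of its representing exit paths is bare. *)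

(* Defs.v *)
From mathcomp Require Import all_boot all_order all_algebra.
From mathcomp Require Import boolp classical_sets functions cardinality.

Set Implicit Arguments.
Unset Strict Implicit.
Unset Printing Implicit Defensive.

Local Open Scope classical_set_scope.

Record digraph := Digraph {
  vertex : Type;
  edge : Type;
  src : edge -> vertex;
  tgt : edge -> vertex;
  countable_vertex : countable [set: vertex];
  countable_edge : countable [set: edge]
}.

Section Digraph.
Variable G : digraph.
Implicit Types (v w : vertex G) (t u : nat -> vertex G).

Definition row_finite : Prop :=
  forall v, finite_set (@src G @^-1` [set v]).

Fixpoint is_walk v (p : seq (edge G)) w : Prop :=
  if p is e :: p' then src e = v /\ is_walk (tgt e) p' w else v = w.

Definition strongly_connected : Prop := forall v w, exists p, is_walk v p w.

(* Sequences are indexed from 0 instead of 1. *)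
Definition exit_path t : Prop :=
  (forall i, exists e : edge G, src e = t i /\ tgt e = t i.+1) /\
  (forall M : set (vertex G), finite_set M ->
     exists N, forall i, (N <= i)%N -> ~ M (t i)).

(* The index j stands for i + k, which is nonnegative for all large i. *)
Definition tail_equiv t u : Prop :=
  exists (k : int) (N : nat), forall i j : nat,
    (N <= i)%N -> (j%:Z = i%:Z + k)%R -> t j = u i.

Definition tail_class t : set (nat -> vertex G) :=
  [set u | exit_path u /\ tail_equiv t u].

Definition exits : set (set (nat -> vertex G)) :=
  [set tail_class t | t in exit_path].

Definition bare_exit_path t : Prop :=
  exit_path t /\
  forall i, (@src G @` (@tgt G @^-1` [set t i.+1]) #= `I_1)%card.

Definition bare_exit (x : set (nat -> vertex G)) : Prop :=
  exits x /\ exists2 t, x t & bare_exit_path t.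

End Digraph.

Arguments exits G : clear implicits.

(* Main.v *)
Require Import Defs.
From mathcomp Require Import all_boot all_order all_algebra.
From mathcomp Require Import boolp classical_sets functions cardinality.
From mathcomp Require Import zify.

Local Open Scope classical_set_scope.

Set Implicit Arguments.
Unset Strict Implicit.
Unset Printing Implicit Defensive.

(** Suppose that no exit is bare. Then every exit path t merges infinitely
    often: for infinitely many i some edge enters t (i+1) from a vertex other
    than t i. From any enumeration of the exit paths, an exit path missing from
    it is built by diagonalization; since tail classes of exit paths are
    countable, this contradicts the countability of the set of exits.

    To leave a prescribed list of paths one needs, again and again, two
    different ways to go on, both of which run away from larger and larger
    finite sets. The edges entering t from outside give a second way provided
    that their sources w_n can be reached from t itself while avoiding a given
    finite set M. This can fail: the w_n may be reachable only through M. In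
    that case a compactness argument (exists_dom: walks to the w_n, cut at their
    last visit to M, accumulate in a locally finite graph) gives an exit path u
    whose vertices all have M-avoiding walks to infinitely many w_n, hence to
    infinitely many vertices of t. So u dominates t, in the preorder dom M, and
    t does not dominate u. Thus the second way exists as soon as t is maximal
    for dom M (maximal_detour).

    The same compactness argument bounds increasing sequences for dom M
    (dom_chain). As there are only countably many exit paths, climbing along
    their enumeration whenever possible and then taking an upper bound produces
    a maximal path above any given one (exists_dom_maximal).

    Finally M has to grow. Take finite sets M_n exhausting the vertices and
    exit paths T n, with T n maximal for dom M_n and T (n+1) above T n for
    dom M_(n+1). Domination avoiding M_(n+1) implies domination avoiding M_n,
    so by maximality T n also dominates T (n+1) for dom M_n. Hence a walk that
    follows T n can make a detour which makes it differ from the n-th listed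
    path (exists_deviation), and then pass to T (n+1), all this avoiding M_n.
    The infinite walk so obtained escapes from every M_n and is not in the list
    (exit_path_outside). *)

(** * Quantifiers along the natural numbers *)

Definition frequently (P : nat -> Prop) : Prop :=
  forall N, exists2 n, N <= n & P n.

Definition eventually (P : nat -> Prop) : Prop :=
  exists N, forall n, N <= n -> P n.

Lemma not_frequently P : ~ frequently P -> eventually (fun n => ~ P n).
Proof.
move=> /existsNP[N PN]; exists N => n Nn Pn; apply: PN; by exists n.
Qed.

Lemma frequently_and P Q :
  frequently P -> eventually Q -> frequently (fun n => P n /\ Q n).
Proof.
move=> fP [N QN] n; have [k] := fP (maxn N n).
by rewrite geq_max => /andP[Nk nk] Pk; exists k => //; split=> //; exact: QN.
Qed.

Lemma frequently_mono (P Q : nat -> Prop) :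
  (forall n, P n -> Q n) -> frequently P -> frequently Q.
Proof. by move=> PQ fP N; have [n Nn /PQ] := fP N; exists n. Qed.

Lemma eventually_and P Q :
  eventually P -> eventually Q -> eventually (fun n => P n /\ Q n).
Proof.
move=> [N PN] [N' QN]; exists (maxn N N') => n.
by rewrite geq_max => /andP[Nn N'n]; split; [exact: PN|exact: QN].
Qed.

Section Graph.
Variable G : digraph.
Implicit Types (v w x y : vertex G) (t u b : nat -> vertex G).
Implicit Types (M : set (vertex G)) (p q : seq (vertex G)).

(** * Walks avoiding a set of vertices *)

Definition adj v w : Prop := exists e : edge G, src e = v /\ tgt e = w.

(** The starting vertex may lie in M, so that walks can leave M. *)
Fixpoint walk M v p : Prop :=
  if p is w :: p' then [/\ adj v w, ~ M w & walk M w p'] else True.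

Definition reach M v w : Prop := exists2 p, walk M v p & last v p = w.

Lemma walk_cat M v p q : walk M v (p ++ q) <-> walk M v p /\ walk M (last v p) q.
Proof.
elim: p v => [|w p IHp] v /=; first by split=> [|[]].
split=> [[vw Mw /IHp[]] // | [[vw Mw wp] wq]].
by split=> //; apply/IHp.
Qed.

Lemma walk_nth x0 M v p i : walk M v p -> i < size p ->
  adj (nth x0 (v :: p) i) (nth x0 p i) /\ ~ M (nth x0 p i).
Proof.
elim: p v i => //= w p IHp v [|i] [vw Mw wp]; first by [].
by rewrite ltnS => /(IHp _ _ wp).
Qed.

Lemma walk_sub M M' v p : M `<=` M' -> walk M' v p -> walk M v p.
Proof.
move=> MM'; elim: p v => //= w p IHp v [vw Mw /IHp wp].
by split=> // /MM'.
Qed.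

Lemma reach_refl M v : reach M v v. Proof. by exists [::]. Qed.

Lemma reach_trans M w v x : reach M v w -> reach M w x -> reach M v x.
Proof.
move=> [p vp <-] [q wq <-]; exists (p ++ q); last by rewrite last_cat.
by apply/walk_cat.
Qed.

Lemma reach_adj M v w : adj v w -> ~ M w -> reach M v w.
Proof. by move=> vw Mw; exists [:: w]. Qed.

Lemma reach_sub M M' v w : M `<=` M' -> reach M' v w -> reach M v w.
Proof. by move=> MM' [p vp pw]; exists p => //; exact: walk_sub vp. Qed.

(** Cut the walk at its last visit to F, or keep it whole if there is none. *)
Lemma last_visit F M v w : reach M v w ->
  reach F v w \/ exists x, [/\ F x, ~ M x & reach F x w].
Proof.
move=> [p + <-]; elim: p v => [|y p IHp] v /=.
  by left; exact: reach_refl.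
move=> [vy My /IHp[yp|]]; last by right.
have [Fy|Fy] := EM (F y); first by right; exists y.
by left; apply: reach_trans yp; exact: reach_adj.
Qed.

(** A walk may be cut at its last return to its starting point. *)
Lemma reach_setU1 M v w : reach M v w -> reach (M `|` [set v]) v w.
Proof.
by move=> /(last_visit (M `|` [set v]))[//|[x [[//|->]]]].
Qed.

Lemma is_walk_reach v (es : seq (edge G)) w : is_walk v es w -> reach set0 v w.
Proof.
elim: es v => [v /= ->|e es IHp v /= [ev /IHp ew]]; first exact: reach_refl.
by apply: reach_trans ew; apply: reach_adj => //; exists e.
Qed.

(** * Leading to a sequence of vertices *)

Definition lead M v b : Prop := frequently (fun i => reach M v (b i)).

(** When u is an exit path and M is finite, this says that late vertices
    of u have M-avoiding walks to arbitrarily late vertices of b. *)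
Definition dom M u b : Prop := forall v, lead M v u -> lead M v b.

Lemma lead_reach M v w b : reach M v w -> lead M w b -> lead M v b.
Proof. by move=> vw; apply: frequently_mono => n; exact: reach_trans. Qed.

Lemma dom_trans M t u b : dom M t u -> dom M u b -> dom M t b.
Proof. by move=> tu ub v /tu /ub. Qed.

(** * Escaping sequences *)

Variable code : vertex G -> nat.
Hypothesis code_inj : injective code.

(** Every finite set of vertices lies in some ball, so the balls stand for all
    finite sets while being indexed by the natural numbers. *)
Definition ball n : set (vertex G) := [set v | code v < n].

Lemma ball_sub m n : m <= n -> ball m `<=` ball n.
Proof. by move=> mn v /=; rewrite /ball /= => /leq_trans; apply. Qed.

(** A ball is finite, so finitely many thresholds have a maximum. *)
Lemma eventually_ball (Q : vertex G -> nat -> Prop) K :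
  (forall v, ball K v -> eventually (Q v)) ->
  eventually (fun n => forall v, ball K v -> Q v n).
Proof.
elim: K => [|K IHK] QK; first by exists 0.
have [|N QN] := IHK; first by move=> v vK; apply/QK/(ball_sub (leqnSn K)).
have [[w wK]|noK] := EM (exists w, code w = K); last first.
  exists N => n Nn v; rewrite /ball /= ltnS leq_eqVlt => /orP[/eqP vK|vK].
    by case: noK; exists v.
  exact: QN.
have [|N' QN'] := QK w; first by rewrite /ball /= wK.
exists (maxn N N') => n; rewrite geq_max => /andP[Nn N'n] v.
rewrite /ball /= ltnS leq_eqVlt => /orP[/eqP vK|vK]; last exact: QN.
have -> : v = w by apply: code_inj; rewrite vK wK.
exact: QN'.
Qed.

Lemma pigeonhole (P : vertex G -> nat -> Prop) K :
  frequently (fun n => exists2 v, ball K v & P v n) ->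
  exists2 v, ball K v & frequently (P v).
Proof.
move=> fP; apply: contrapT => noP.
have [|N PN] := @eventually_ball (fun v n => ~ P v n) K.
  by move=> v vK; apply: not_frequently => fPv; apply: noP; exists v.
have [n Nn [v vK Pv]] := fP N; exact: PN Pv.
Qed.

Definition escapes b : Prop := forall K, eventually (fun i => ~ ball K (b i)).

Lemma escapesP b : (forall v, eventually (fun i => b i <> v)) -> escapes b.
Proof.
move=> bv K; have [|N bN] := @eventually_ball (fun v i => b i <> v) K.
  by move=> v _; exact: bv.
by exists N => i Ni bK; apply: bN Ni _ bK _.
Qed.

Lemma escapes_neq b v : escapes b -> eventually (fun i => b i <> v).
Proof.
move=> /(_ (code v).+1)[N bN]; exists N => i /bN + biv.
by apply; rewrite biv /ball /= ltnSn.
Qed.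

Lemma inj_escapes b : injective b -> escapes b.
Proof.
move=> b_inj; apply: escapesP => v.
have [[k bk]|nob] := EM (exists k, b k = v); last first.
  by exists 0 => i _ biv; apply: nob; exists i.
exists k.+1 => i ki; rewrite -bk => /b_inj ik; by rewrite ik ltnn in ki.
Qed.

Lemma ball_finite K : finite_set (ball K).
Proof.
have -> : ball K = code @^-1` `I_K by [].
by apply: finite_preimage; [move=> v w _ _; exact: code_inj|exact: finite_II].
Qed.

Lemma finite_sub_ball M : finite_set M -> exists K, M `<=` ball K.
Proof.
move=> /(finite_image code)/finite_seqP[s Ms].
exists (\max_(n <- s) n).+1 => v Mv; rewrite /ball /= ltnS.
apply: (@leq_bigmax_seq _ _ _ id) => //.
suff : [set` s] (code v) by [].
by rewrite -Ms; exists v.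
Qed.

Lemma exit_pathP t :
  exit_path t <-> (forall i, adj (t i) (t i.+1)) /\ escapes t.
Proof.
split=> [[te tM]|[te tesc]]; split=> //.
  by move=> K; have [N tN] := tM _ (ball_finite K); exists N.
move=> M /finite_sub_ball[K MK]; have [N tN] := tesc K.
by exists N => i /tN + /MK.
Qed.

Lemma exit_path_adj t i : exit_path t -> adj (t i) (t i.+1).
Proof. by move=> /exit_pathP[]. Qed.

Lemma exit_path_escapes t : exit_path t -> escapes t.
Proof. by move=> /exit_pathP[]. Qed.

(** An exit path has no period, as it would revisit a vertex forever. *)
Lemma exit_path_shift_inj t i j : exit_path t ->
  (forall m, t (i + m) = t (j + m)) -> i = j.
Proof.
move=> /exit_path_escapes tesc.
wlog ij : i j / i < j => [wl tij|tij].
  case: (ltngtP i j) => // [ij|ji]; first exact: wl.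
  by apply/esym/wl => // m; rewrite tij.
have per k : t (i + k * (j - i)) = t i.
  elim: k => [|k IHk]; first by rewrite mul0n addn0.
  by rewrite mulSn addnA subnKC ?(ltnW ij)// -tij.
have [N tN] := escapes_neq (t i) tesc.
case: (tN (i + N * (j - i))) (per N) => //.
by apply: leq_trans (leq_addl _ _); apply: leq_pmulr; rewrite subn_gt0.
Qed.

Definition segment t i m : seq (vertex G) := mkseq (fun j => t (i + j).+1) m.

Lemma last_segment t i m : last (t i) (segment t i m) = t (i + m).
Proof. by case: m => [|m]; rewrite ?addn0// /segment mkseqS last_rcons addnS. Qed.

Lemma walk_segment M t i m : exit_path t -> (forall n, i < n -> ~ M (t n)) ->
  walk M (t i) (segment t i m).
Proof.
move=> tex tM; elim: m => // m IHm.
rewrite /segment mkseqS -cats1; apply/walk_cat; split=> //.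
rewrite -/(segment t i m) last_segment; split=> //; first exact: exit_path_adj.
by apply: tM; rewrite ltnS leq_addr.
Qed.

Lemma exit_path_reach M t N : exit_path t -> (forall n, N <= n -> ~ M (t n)) ->
  forall i j, N <= i -> i <= j -> reach M (t i) (t j).
Proof.
move=> tex tM i j Ni ij; exists (segment t i (j - i)).
  by apply: walk_segment => // n /ltnW /(leq_trans Ni); exact: tM.
by rewrite last_segment subnKC.
Qed.

Hypothesis Grf : row_finite G.
Hypothesis Gsc : strongly_connected G.

Lemma adj_ball v : exists K, forall w, adj v w -> ball K w.
Proof.
have [K EK] := finite_sub_ball (finite_image (@tgt G) (Grf v)).
by exists K => w [e [ev ew]]; apply: EK; exists e.
Qed.

Lemma adj_ball_ball K : exists K', forall v w, ball K v -> adj v w -> ball K' w.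
Proof.
have [|K' HK] := @eventually_ball (fun v n => forall w, adj v w -> ball n w) K.
  move=> v _; have [K' vK'] := adj_ball v.
  by exists K' => n K'n w /vK'; exact: ball_sub.
by exists K' => v w vK; exact: HK.
Qed.

(** * Compactness *)

(** A walk from v to b n that does not return to v must leave v by one of
    finitely many successors, so one successor serves infinitely many n. *)
Lemma lead_step M v b : escapes b -> lead M v b ->
  exists y, [/\ adj v y, ~ (M `|` [set v]) y & lead (M `|` [set v]) y b].
Proof.
move=> besc vb; have [K vK] := adj_ball v.
pose M' := M `|` [set v].
suff [y yK yP] : exists2 y, ball K y &
    frequently (fun n => [/\ adj v y, ~ M' y & reach M' y (b n)]).
  exists y; have [_ _ [vy My _]] := yP 0; split=> //.
  by apply: frequently_mono yP => n [].
apply: pigeonhole; move: (frequently_and vb (escapes_neq v besc)).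
apply: frequently_mono => n [/reach_setU1[[|y p] /=]]; first by move=> _ ->.
by move=> [vy My yp] pb _; exists y; [exact: vK|split=> //; exists p].
Qed.

(** A form of the infinity lemma of Koenig. Iterating lead_step, where each
    visited vertex joins the set to avoid, gives an infinite path that never
    repeats a vertex; such a path escapes from every finite set. *)
Lemma lead_exit_path M v b : escapes b -> lead M v b ->
  exists2 u, exit_path u & forall k, lead M (u k) b.
Proof.
move=> besc vb.
have /choice[f fP] : forall z : set (vertex G) * vertex G, exists y,
    lead z.1 z.2 b -> [/\ adj z.2 y, ~ (z.1 `|` [set z.2]) y &
                        lead (z.1 `|` [set z.2]) y b].
  move=> [M' x]; have [/(lead_step besc)[y yP]|nl] := EM (lead M' x b).
    by exists y.
  by exists x => /nl.
(* The state is the set of vertices to avoid, with the current vertex. *)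
pose st := fix st n := if n is n'.+1
  then ((st n').1 `|` [set (st n').2], f (st n')) else (M, v).
pose u n := (st n).2.
have stl n : lead (st n).1 (u n) b by elim: n => //= n /fP[].
have sts m n : m <= n -> (st m).1 `<=` (st n).1.
  elim: n => [|n IHn]; first by rewrite leqn0 => /eqP->.
  rewrite leq_eqVlt => /orP[/eqP->//|/IHn mn]; apply: subset_trans mn _ => /=.
  by move=> x; left.
have neq i j : i < j -> u i <> u j.
  case: j => // j ij uij; have [_ /= + _] := fP _ (stl j).
  rewrite -[f _]/(u j.+1) -uij; apply.
  by apply: (sts i.+1 j.+1 ij) => /=; right.
exists u; last first.
  move=> k; apply: frequently_mono (stl k) => n; apply: reach_sub.
  exact: (sts 0).
apply/exit_pathP; split=> [i|]; first by have [] := fP _ (stl i).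
apply: inj_escapes => i j uij; case: (ltngtP i j) => // /neq; by rewrite uij.
Qed.

(** Strong connectivity supplies walks to the vertices of b from a fixed
    vertex, and cutting them at their last visit to the ball gives
    ball-avoiding walks from finitely many starting points. *)
Lemma exists_dom b K : escapes b -> exists2 u, exit_path u & dom (ball K) u b.
Proof.
move=> besc; pose v0 := b 0; pose K' := maxn K (code v0).+1.
have [v _ vb] : exists2 v, ball K' v & lead (ball K) v b.
  apply: pigeonhole => N; exists N => //.
  have [p /is_walk_reach v0b] := Gsc v0 (b N).
  have [|[x [xK _ xb]]] := last_visit (ball K) v0b.
    by exists v0 => //; rewrite /ball /= leq_max ltnSn orbT.
  by exists x => //; apply: (ball_sub _ xK); exact: leq_maxl.
have [u uex ub] := lead_exit_path besc vb.
by exists u => // x /(_ 0)[k _ xu]; exact: lead_reach (ub k).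
Qed.

(** * Maximal exit paths *)

Lemma exit_path_lead K t : exit_path t ->
  eventually (fun i => lead (ball K) (t i) t).
Proof.
move=> tex; have [N tN] := exit_path_escapes tex K.
exists N => i Ni n; exists (maxn i n); first exact: leq_maxr.
exact: (exit_path_reach tex tN Ni (leq_maxl _ _)).
Qed.

(** Walks that are to avoid the small ball may first join the tail of u, and
    there the stronger avoidance is at hand. *)
Lemma dom_ball_sub K K' t u : K <= K' -> exit_path u ->
  dom (ball K') u t -> dom (ball K) u t.
Proof.
move=> KK' uex ut v vu.
have [i _ [vi /ut]] := frequently_and vu (exit_path_lead K' uex) 0.
move=> /(frequently_mono (fun n => reach_sub (ball_sub KK'))).
exact: lead_reach.
Qed.

(** Choose a vertex on each T n, further and further away: an exit path leading
    to infinitely many of them dominates all T n. *)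
Lemma dom_chain K (T : nat -> nat -> vertex G) :
  (forall n, exit_path (T n)) -> (forall n, dom (ball K) (T n.+1) (T n)) ->
  exists2 u, exit_path u & forall n, dom (ball K) u (T n).
Proof.
move=> Tex Tdom.
have Tle m n : m <= n -> dom (ball K) (T n) (T m).
  elim: n => [|n IHn]; first by rewrite leqn0 => /eqP->.
  rewrite leq_eqVlt => /orP[/eqP->//|/IHn]; exact: dom_trans.
have /choice[b bP] : forall n, exists v, ~ ball n v /\ lead (ball K) v (T n).
  move=> n; have [N TN] := eventually_and (exit_path_escapes (Tex n) n)
    (exit_path_lead K (Tex n)).
  by exists (T n N); exact: TN.
have besc : escapes b.
  by move=> k; exists k => n /ball_sub kn /kn; have [] := bP n.
have [u uex ub] := exists_dom K besc.
exists u => // m v /ub /(_ m)[n mn vb].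
by apply: (Tle _ _ mn); apply: lead_reach vb _; have [] := bP n.
Qed.

Definition dom_maximal M t : Prop :=
  forall u, exit_path u -> dom M u t -> dom M t u.

(** Starting at t, move to the n-th exit path whenever it dominates the current
    one. An upper bound u of this chain is maximal: if the n-th exit path
    dominates u, then it was chosen at step n and so lies below u. *)
Lemma exists_dom_maximal (e : nat -> nat -> vertex G) K t :
  (forall s, exit_path s -> exists n, e n = s) -> exit_path t ->
  exists t', [/\ exit_path t', dom (ball K) t' t & dom_maximal (ball K) t'].
Proof.
move=> eP tex.
pose next n t := if pselect (exit_path (e n) /\ dom (ball K) (e n) t)
  then e n else t.
pose T := fix T n := if n is n'.+1 then next n' (T n') else t.
have Tex n : exit_path (T n).
  by elim: n => //= n IHn; rewrite /next; case: pselect => // -[].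
have Tdom n : dom (ball K) (T n.+1) (T n).
  by rewrite /= /next; case: pselect => [[]|_] // v.
have [u uex uT] := dom_chain Tex Tdom.
exists u; split=> //; first exact: (uT 0).
move=> s /[dup] sex /eP[n ens] su.
have : dom (ball K) u (T n.+1) by [].
rewrite /= /next ens; case: pselect => // -[]; split=> //.
exact: dom_trans su (uT n).
Qed.

(** Failure of the bareness condition at the edge from t i to t (i+1). *)
Definition merges t i : Prop := exists2 w, adj w (t i.+1) & w <> t i.

(** The sources w_n of the edges entering t from outside escape, because their
    successors on t do. An exit path u that dominates them dominates t as well,
    so by maximality t dominates u, and hence leads to the w_n. *)
Lemma maximal_detour K t : exit_path t -> frequently (merges t) ->
  dom_maximal (ball K) t ->
  forall v, lead (ball K) v t -> frequently (fun i =>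
    exists w, [/\ adj w (t i.+1), w <> t i & reach (ball K) v w]).
Proof.
move=> tex tm tmax v vt.
have tesc := exit_path_escapes tex.
have /choice[z zP] : forall n, exists z : nat * vertex G,
    [/\ n <= z.1, adj z.2 (t z.1.+1) & z.2 <> t z.1].
  by move=> n; have [i ni [w wt wi]] := tm n; exists (i, w).
pose b n := (z n).2.
have besc : escapes b.
  move=> k; have [k' kk'] := adj_ball_ball k; have [N tN] := tesc k'.
  exists N => n Nn bk; have [nz bt _] := zP n.
  apply: (tN (z n).1.+1); last exact: kk' bk bt.
  exact: leq_trans Nn (leqW nz).
have [u uex ub] := exists_dom K besc.
have ut : dom (ball K) u t.
  move=> x /ub xb; have [N tN] := tesc K.
  move=> n; have [m] := xb (maxn N n); rewrite geq_max => /andP[Nm nm] xbm.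
  have [mz bt _] := zP m; exists (z m).1.+1.
    exact: leq_trans nm (leqW mz).
  apply: reach_trans xbm _; apply: reach_adj => //; apply: tN.
  exact: leq_trans Nm (leqW mz).
move=> n; have [m nm vb] := ub _ (tmax _ uex ut _ vt) n.
have [mz bt bz] := zP m; exists (z m).1; first exact: leq_trans mz.
by exists (b m).
Qed.

(** * An exit path outside a given list *)

(** The diagonal step: f is the path to be avoided and c is the number of
    vertices that precede those of q in the path under construction. If all
    candidates q agreed with f, then f would follow t from some time on, and
    also follow t after a detour through a vertex w <> t l into t (l+1). The two
    descriptions of f force a period of t unless the detour has the length of
    the direct segment of t; but then w would equal t l. *)
Lemma exists_deviation K t (f : nat -> vertex G) v c :
  exit_path t -> frequently (merges t) -> dom_maximal (ball K) t ->
  lead (ball K) v t ->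
  exists q, [/\ walk (ball K) v q, lead (ball K) (last v q) t &
    exists2 d, d < size q & nth v q d <> f (c + d)].
Proof.
move=> tex tm tmax vt; apply: contrapT => noq.
have follow q d : walk (ball K) v q -> lead (ball K) (last v q) t ->
    d < size q -> nth v q d = f (c + d).
  move=> vq qt dq; apply: contrapT => qd; apply: noq; exists q; split=> //.
  by exists d.
have [N tN] := eventually_and (exit_path_escapes tex K) (exit_path_lead K tex).
have tK i j : N <= i -> i < j -> ~ ball K (t j).
  by move=> Ni /ltnW ij; case: (tN j (leq_trans Ni ij)).
have [i Ni [p vp pi]] := vt N.
have vfollow q j m : walk (ball K) v q -> last v q = t j -> N <= j ->
    t (j + m).+1 = f (c + (size q + m)).
  move=> vq qj Nj; have jqm : last v (q ++ segment t j m.+1) = t (j + m.+1).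
    by rewrite last_cat qj last_segment.
  rewrite -(follow (q ++ segment t j m.+1)) ?size_cat ?size_mkseq ?ltn_add2l//.
  - by rewrite nth_cat ltnNge leq_addr/= addKn nth_mkseq.
  - apply/walk_cat; split=> //; rewrite qj; apply: walk_segment => // n.
    exact: tK.
  - by rewrite jqm; case: (tN (j + m.+1) (leq_trans Nj (leq_addr _ _))).
have [_ ti] := tN i Ni.
have [l il [w [wl wtl [q iq qw]]]] := maximal_detour tex tm tmax ti i.
have Nl := leq_trans Ni il.
have vpq : walk (ball K) v (p ++ q) by apply/walk_cat; rewrite pi.
have tl : ~ ball K (t l.+1) by apply: tK Nl _.
have wt : lead (ball K) w t.
  by apply: lead_reach (reach_adj wl tl) _; case: (tN _ (leqW Nl)).
(* The detour follows f, which follows t from t i on; so w is the vertex of t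
   found size q steps after t i. *)
have wE : w = t (i + size q).
  rewrite -qw; case: (lastP q) iq qw vpq => [|q' y] iq qw vpq.
    by rewrite addn0.
  rewrite last_rcons in qw *.
  rewrite size_rcons addnS (vfollow p)// -(follow (p ++ rcons q' y))//.
  - by rewrite nth_cat ltnNge leq_addr/= addKn nth_rcons ltnn eqxx.
  - by rewrite last_cat last_rcons qw.
  - by rewrite size_cat size_rcons ltn_add2l.
(* After w the walk continues at t (l+1), and f also at t (i + size q + 1). *)
have : l.+2 = (i + size q).+2.
  apply: (exit_path_shift_inj tex) => m; rewrite (addSn l.+1).
  have -> : (i + size q).+2 + m = (i + (size q + m.+1)).+1.
    by rewrite addnA addnS !addSn.
  rewrite (vfollow p i)// (vfollow (rcons (p ++ q) (t l.+1)) l.+1).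
  - by rewrite size_rcons size_cat addSnnS -addnA.
  - by rewrite -cats1; apply/walk_cat; rewrite last_cat pi qw.
  - by rewrite last_rcons.
  - exact: leqW.
by move=> [lE]; apply: wtl; rewrite wE lE.
Qed.

(** The walk is a union of finite pieces. The n-th piece avoids the n-th ball,
    starts at a vertex that leads to T n, deviates from e n and ends at a vertex
    that leads to T (n+1) while avoiding the next ball. *)
Lemma exit_path_outside (e : nat -> nat -> vertex G) (T : nat -> nat -> vertex G) :
  (forall n, [/\ exit_path (T n), frequently (merges (T n)),
    dom_maximal (ball n) (T n) & dom (ball n) (T n) (T n.+1)]) ->
  exists2 s, exit_path s & forall n, e n <> s.
Proof.
move=> TP; have Tex n : exit_path (T n) by case: (TP n).
have [N0 /(_ _ (leqnn _)) T0] := exit_path_lead 0 (Tex 0).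
pose x := T 0 N0.
have /choice[f fP] : forall z : nat * seq (vertex G), exists q,
    lead (ball z.1) (last x z.2) (T z.1) ->
    [/\ walk (ball z.1) (last x z.2) q,
      lead (ball z.1.+1) (last x (z.2 ++ q)) (T z.1.+1) &
      exists2 d, d < size q &
        nth x q d <> e z.1 (size z.2 + d)].
  move=> [n p] /=; have [pT|npT] := EM (lead (ball n) (last x p) (T n));
    last by exists [::] => /npT.
  have [_ Tm Tmax Tdom] := TP n.
  have [q [pq qT [d dq qd]]] :=
    exists_deviation (e n) (size p) (Tex n) Tm Tmax pT.
  (* Pass to T (n+1), late enough for its tail to avoid the next ball. *)
  have [N TN] := exit_path_lead n.+1 (Tex n.+1).
  have [i Ni [r qr ri]] := Tdom _ qT N.
  exists (q ++ r) => _; split.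
  - exact/walk_cat.
  - by rewrite !last_cat ri; exact: TN.
  - exists d; first by rewrite size_cat ltn_addr.
    by rewrite nth_cat dq (set_nth_default (last x p)).
pose P := fix P n := if n is n'.+1 then P n' ++ f (n', P n') else [::].
have Plead n : lead (ball n) (last x (P n)) (T n).
  by elim: n => //= n /(fP (n, P n))[].
have fPn n := fP (n, P n) (Plead n).
have Pext m n : m <= n -> exists2 r, P n = P m ++ r &
    walk (ball m) (last x (P m)) r.
  elim: n => [|n IHn]; first by rewrite leqn0 => /eqP->; exists [::].
  rewrite leq_eqVlt => /orP[/eqP->|mn]; first by exists [::]; rewrite ?cats0.
  have [r Pr mr] := IHn mn; exists (r ++ f (n, P n)) => /=.
    by rewrite [in LHS]Pr catA -Pr.
  apply/walk_cat; split=> //; rewrite -last_cat -Pr.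
  have [+ _ _] := fPn n; apply: walk_sub; exact: ball_sub.
have Psize n : n <= size (P n).
  elim: n => //= n IHn; have [_ _ [d dq _]] := fPn n.
  by rewrite size_cat -addn1 leq_add// (leq_trans _ dq).
pose s i := nth x (P i.+1) i.
have sP n i : i < size (P n) -> s i = nth x (P n) i.
  move=> iPn; rewrite /s; have [ni|ni] := leqP n i.+1.
    by have [r -> _] := Pext _ _ ni; rewrite nth_cat iPn.
  by have [r -> _] := Pext _ _ (ltnW ni); rewrite nth_cat Psize.
exists s; last first.
  move=> n en; have [_ _ [d dq]] := fPn n; apply.
  rewrite /= en (sP n.+1) /=; last by rewrite size_cat ltn_add2l.
  by rewrite nth_cat ltnNge leq_addr/= addKn.
apply/exit_pathP; split=> [i|K].
  have [r Pr] := Pext 0 i.+2 isT; rewrite -[r]/(P 0 ++ r) -Pr => wP.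
  have [+ _] := walk_nth x wP (Psize i.+2).
  rewrite -[nth x (_ :: _) _]/(nth x (P i.+2) i) -!sP//.
  exact: leq_trans (Psize i.+2).
exists (size (P K)) => i Ki.
have [|r Pr wr] := Pext K i.+1; first exact: leq_trans (Psize K) (leqW Ki).
have iP := Psize i.+1; rewrite Pr size_cat in iP.
have [|_] := walk_nth x (i := i - size (P K)) wr; first by rewrite ltn_subLR.
by rewrite /s Pr nth_cat ltnNge Ki.
Qed.

(** * Counting exit paths *)

Lemma tail_class_refl t : exit_path t -> tail_class t t.
Proof.
move=> tex; split=> //; exists 0%R, 0 => i j _ ji.
by congr t; move: ji; rewrite GRing.addr0 => -[].
Qed.

(** An exit path coincides from some time on with a shift of a representative of
    its class, so a class index n, a shift j and a finite initial part p
    determine it. *)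
Lemma exit_paths_enumerable (s0 : nat -> vertex G) : countable (exits G) ->
  exists e : nat -> nat -> vertex G, forall s, exit_path s -> exists n, e n = s.
Proof.
move=> /countable_injP[c c_inj].
have /choice[r rP] : forall n, exists t,
    (exists2 s, exit_path s & c (tail_class s) = n) ->
    exit_path t /\ c (tail_class t) = n.
  move=> n; have [[s sex sn]|nos] := EM (exists2 s, exit_path s & c (tail_class s) = n).
    by exists s.
  by exists s0 => /nos.
have /choice[h hP] : forall n, exists v, forall w, code w = n -> v = w.
  move=> n; have [[v vn]|nov] := EM (exists v, code v = n).
    by exists v => w wn; apply: code_inj; rewrite vn wn.
  by exists (s0 0) => w wn; case: nov; exists w.
exists (fun z => if unpickle z is Some (n, j, p) then
  fun i => if i < size p then h (nth 0 p i) else r n (i - size p + j)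
  else s0) => s sex.
have [|rex rs] := rP (c (tail_class s)); first by exists s.
set n := c (tail_class s) in rex rs.
have := tail_class_refl sex.
rewrite -(c_inj _ _ _ _ rs); first last.
- by rewrite inE; exists s.
- by rewrite inE; exists (r n).
move=> [_ [k [N rk]]].
(* Starting after |k| steps makes the shifted index nonnegative. *)
pose i0 := N + `|k|%N; pose j0 := `|(Posz i0 + k)%R|%N.
have j0E : Posz j0 = (Posz i0 + k)%R by rewrite /j0 gez0_abs// /i0; lia.
exists (pickle (n, j0, [seq code (s i) | i <- iota 0 i0])).
rewrite pickleK; apply/funext => i; rewrite size_map size_iota.
case: ltnP => ii.
  by apply: hP; rewrite (nth_map 0) ?size_iota// nth_iota.
apply: rk; first by rewrite (leq_trans _ ii)// leq_addr.
by rewrite PoszD j0E; lia.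
Qed.

Lemma exists_exit_path : infinite_set [set: vertex G] ->
  exists t, @exit_path G t.
Proof.
move=> Vinf; have /choice[b bP] : forall n, exists v, ~ ball n v.
  move=> n; apply/existsNP => nball; apply: Vinf.
  by apply: sub_finite_set (ball_finite n).
have [|u uex _] := @exists_dom b 0; last by exists u.
by move=> k; exists k => n /ball_sub kn /kn; exact: bP.
Qed.

Lemma bare_exit_path_tail t : exit_path t ->
  eventually (fun i => ~ merges t i) -> exists u, bare_exit_path u.
Proof.
move=> tex [N tN]; exists (fun i => t (N + i)); split.
  apply/exit_pathP; split=> [i|K].
    by rewrite addnS; exact: exit_path_adj.
  have [N' tK] := exit_path_escapes tex K.
  by exists N' => i N'i; apply: tK; rewrite (leq_trans N'i)// leq_addl.
move=> i; have -> : @src G @` (@tgt G @^-1` [set t (N + i.+1)]) = [set t (N + i)].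
  apply/seteqP; split=> [_ [f ft <-]|_ ->] /=.
    apply: contrapT => ne; apply: (tN (N + i) (leq_addr _ _)).
    exists (src f) => //; exists f; split=> //.
    by rewrite -addnS.
  have [f [fs ft]] := exit_path_adj (N + i) tex.
  by exists f => //=; rewrite addnS.
exact: card_set1.
Qed.

End Graph.

Theorem theorem9p1 (G : digraph)
    (Gsc : strongly_connected G) (Grf : row_finite G)
    (Ginf : infinite_set [set: vertex G])
    (Gexits : countable (exits G)) :
  exists x : set (nat -> vertex G), bare_exit x.
Proof.
have /countable_injP[code code_in] := @countable_vertex G.
have code_inj : injective code by move=> v w; apply: code_in; rewrite inE.
apply: contrapT => nobare.
have merging (t : nat -> vertex G) : exit_path t -> frequently (merges t).
  move=> tex; apply: contrapT => /not_frequently/(bare_exit_path_tail code_inj tex).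
  move=> [u ubare]; apply: nobare; exists (tail_class u); split.
    by exists u => //; case: ubare.
  by exists u => //; apply: tail_class_refl; case: ubare.
have [t0 t0ex] := exists_exit_path code_inj Grf Gsc Ginf.
have [e eP] := exit_paths_enumerable code_inj t0 Gexits.
have /choice[next nextP] : forall z : nat * (nat -> vertex G), exists t,
    exit_path z.2 -> [/\ exit_path t, dom (ball code z.1) t z.2 &
                      dom_maximal (ball code z.1) t].
  move=> [n t]; have [tex|] := EM (exit_path t); last by exists t.
  by have [t' ?] := exists_dom_maximal code_inj Grf Gsc n eP tex; exists t'.
pose T := fix T n := next (n, if n is n'.+1 then T n' else t0).
have Tex n : exit_path (T n).
  by elim: n => [|n IHn]; [case: (nextP (0, t0))|case: (nextP (n.+1, T n))].
have [|s sex] := @exit_path_outside G code code_inj Grf Gsc e T; last first.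
  by have [n <-] := eP s sex => /(_ n).
move=> n; have Tmax : dom_maximal (ball code n) (T n).
  by case: n => [|n]; [case: (nextP (0, t0))|case: (nextP (n.+1, T n) (Tex n))].
split=> //; first exact: merging.
apply: Tmax => //; apply: (dom_ball_sub code_inj (leqnSn n)) => //.
by have [] := nextP (n.+1, T n) (Tex n).
Qed.
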